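(* Let $G=(V,E)$ be a finite directed graph with edge weights $w:E\to[0,\infty)$ satisfying $\sum_{u\in N^{in}(v)}w(u,v)\le 1$ for all $v\in V$, and autonomy factors $q^+,q^-:V\to[0,\infty)$ with $q^+(v)+q^-(v)\le 1$ for all $v\in V$. For $S\subseteq V$ let $f^+(S)$ be the expected number of positive nodes at the end of the LT-N diffusion process with seed set $S$. Then $f^+$ is monotone and submodular: for all $S\subseteq R\subseteq V$ and $v\in V\setminus R$, $f^+(S)\le f^+(R)$ and $f^+(S\cup\{v\})-f^+(S)\ge f^+(R\cup\{v\})-f^+(R)$.
   Context: $N^{in}(v)=\{u:(u,v)\in E\}$ and $r(v)=q^+(v)+q^-(v)$. LT-N (negativity-aware linear threshold) diffusion from seed set $S$. Each node is inactive, positive or negative. Each $v\in V\setminus S$ independently samples a threshold $b_v$ uniformly from $[0,1]$. Let $A_\tau,A_\tau^+,A_\tau^-$ denote the sets of active, positive and negative nodes by the end of step $\tau$ (so $A_\tau=A_\tau^+\cup A_\tau^-$, and nodes never change state once active). $A_0=A_0^+=A_0^-=\emptyset$; $A_1=A_1^+=S$, $A_1^-=\emptyset$. In each step $\tau\ge 2$, every inactive node $v\in V\setminus A_{\tau-1}$ with $\sum_{u\in N^{in}(v)\cap A_{\tau-1}}w(u,v)\ge b_v$ becomes active. Given that it becomes active in step $\tau$, it turns positive with probability $$q^+(v)+[1-r(v)]\,\frac{\sum_{u\in N^{in}(v)\cap(A^+_{\tau-1}\setminus A_{\tau-2})}w(u,v)}{\sum_{u\in N^{in}(v)\cap(A_{\tau-1}\setminus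 A_{\tau-2})}w(u,v)}$$ and negative otherwise; these sign choices are made independently across nodes. (Up to probability zero, the denominator is positive whenever $v$ becomes active in step $\tau$.) The process stops when no more inactive node can be activated. *)

(* Defs.v *)
From HB Require Import structures.
From mathcomp Require Import all_boot all_order all_algebra.
From mathcomp Require Import all_classical all_reals all_analysis.

Set Implicit Arguments.
Unset Strict Implicit.
Unset Printing Implicit Defensive.

Import Order.TTheory GRing.Theory Num.Theory.
Local Open Scope classical_set_scope.
Local Open Scope ring_scope.

Section UnitCube.
Variable R : realType.
Local Notation U := (measurableTypeR R).

Definition cons_tuple (n : nat) (x : U * n.-tuple U) : n.+1.-tuple U :=
  [tuple of x.1 :: x.2].

Lemma measurable_cons_tuple (n : nat) :
  measurable_fun [set: U * n.-tuple U] (@cons_tuple n).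
Proof. exact: measurable_cons. Qed.

HB.instance Definition _ (n : nat) :=
  isMeasurableFun.Build _ _ _ _ (@cons_tuple n) (@measurable_cons_tuple n).

(* The law of n independent uniform variables on [0, 1]: the n-fold product of
   the uniform probability, transported along R * R^n -> R^(n+1). *)
Fixpoint cube_prob (n : nat) : probability (n.-tuple U) R :=
  match n with
  | 0 => \d_([tuple] : 0.-tuple U)
  | m.+1 => distribution (uniform_prob (@ltr01 R) \x cube_prob m)%E
                         (@cons_tuple m)
  end.

Lemma cube_prob_box (n : nat) (B : 'I_n -> set U) :
  (forall i, measurable (B i)) ->
  cube_prob n [set x | forall i, B i (tnth x i)] =
  (\prod_(i < n) uniform_prob (@ltr01 R) (B i))%E.
Proof.
elim: n B => [|n IHn] B mB.
  rewrite big_ord0 /= diracE mem_set//; by case.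
rewrite big_ord_recl -IHn// -product_measure1E//=; last first.
  rewrite [X in measurable X](_ : _ =
    \bigcap_(i in [set: 'I_n]) [set x | B (lift ord0 i) (tnth x i)]).
    apply: fin_bigcap_measurable => // i _.
    rewrite -[X in measurable X]setTI.
    exact: (@measurable_tnth _ U n i).
  by apply/seteqP; split=> x /= h i; [move=> _|]; exact: h.
rewrite /distribution /pushforward; congr (_ _).
apply/seteqP; split => -[x y] /= h.
  split; first exact: (h ord0).
  by move=> i; have := h (lift ord0 i); rewrite /cons_tuple/= tnthS.
move=> i; case: (unliftP ord0 i) => [j ->|->]; last exact: h.1.
by rewrite /cons_tuple/= tnthS; exact: h.2.
Qed.

End UnitCube.

Section LTN.
Variables (R : realType) (V : finType) (E : rel V).
Variables (w : V -> V -> R) (qp qm : V -> R).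

Definition Nin (v : V) : {set V} := [set u | E u v].

Definition rfac (v : V) : R := qp v + qm v.

Definition inweight (A : {set V}) (v : V) : R :=
  \sum_(u in Nin v :&: A) w u v.

(* [prev], [pos], [neg] stand for A_(tau-2), A+_(tau-1), A-_(tau-1).  When the
   denominator vanishes, which has probability zero at an activation, the
   quotient is 0 by convention. *)
Definition pos_prob (prev pos neg : {set V}) (v : V) : R :=
  qp v + (1 - rfac v) *
    (inweight (pos :\: prev) v / inweight ((pos :|: neg) :\: prev) v).

(* One step given thresholds [b].  The sign choice of [v] is a biased coin
   realized by a variable [c v], uniform on [0, 1] and independent of all other
   choices: [v] turns positive when [c v] is below the required probability.
   Each node is activated at most once, hence one such variable per node. *)
Definition ltn_step (b c : V -> R) (st : {set V} * {set V} * {set V}) :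
    {set V} * {set V} * {set V} :=
  let: (prev, pos, neg) := st in
  let act := pos :|: neg in
  let new := [set v in ~: act | b v <= inweight act v] in
  let newpos := [set v in new | c v < pos_prob prev pos neg v] in
  (act, pos :|: newpos, neg :|: (new :\: newpos)).

(* (A_(tau-1), A+_tau, A-_tau), with A_(-1) read as the empty set. *)
Fixpoint ltn_state (S : {set V}) (b c : V -> R) (tau : nat) :
    {set V} * {set V} * {set V} :=
  match tau with
  | 0 => (finset.set0, finset.set0, finset.set0)
  | 1 => (finset.set0, S, finset.set0)
  | tau'.+1 => ltn_step b c (ltn_state S b c tau')
  end.

Definition positives S b c tau : {set V} := (ltn_state S b c tau).1.2.
Definition negatives S b c tau : {set V} := (ltn_state S b c tau).2.
Definition actives S b c tau : {set V} :=
  positives S b c tau :|: negatives S b c tau.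

(* Every step from the second on activates a node or is the last one, so the
   process has stopped by step #|V|.+1; see [positives_stop]. *)
Definition final_positives S b c : {set V} := positives S b c #|V|.+1.

Lemma ltn_stateSS S b c tau : ltn_state S b c tau.+2 =
  ltn_step b c (ltn_state S b c tau.+1).
Proof. by []. Qed.

Lemma activesS S b c tau : actives S b c tau.+2 = actives S b c tau.+1 :|:
  [set v in ~: actives S b c tau.+1 |
     b v <= inweight (actives S b c tau.+1) v].
Proof.
rewrite /actives /positives /negatives ltn_stateSS.
case: (ltn_state S b c tau.+1) => -[prev pos] neg /=.
by apply/setP => v; rewrite !inE; do ! case: (_ \in _) => //=;
  do ! case: (_ <= _) => //=; case: (_ < _).
Qed.

Lemma positivesS S b c tau : actives S b c tau.+2 = actives S b c tau.+1 ->
  positives S b c tau.+2 = positives S b c tau.+1.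
Proof.
rewrite activesS => /setP nonew; move: nonew.
rewrite /actives /positives /negatives ltn_stateSS.
case: (ltn_state S b c tau.+1) => -[prev pos] neg /= nonew.
apply/setP => v; move: (nonew v); rewrite !inE.
by do ! case: (_ \in _) => //=; case: (_ <= _).
Qed.

Lemma actives_stable S b c tau : actives S b c tau.+2 = actives S b c tau.+1 ->
  forall k, actives S b c (k + tau).+1 = actives S b c tau.+1.
Proof.
move=> e; elim=> [//|k IHk].
by rewrite addSn activesS IHk -activesS.
Qed.

Lemma positives_stop S b c tau : (#|V| < tau)%N ->
  positives S b c tau = final_positives S b c.
Proof.
have grow t : (forall s, (s < t)%N ->
    actives S b c s.+2 <> actives S b c s.+1) ->
    (t <= #|actives S b c t.+1|)%N.
  elim: t => [//|t IHt] h.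
  apply: (leq_ltn_trans (IHt _)) => [s st|]; first by apply: h; rewrite ltnW.
  apply: proper_card; rewrite finset.properEneq; apply/andP; split.
    by apply/eqP => e; apply: (h t).
  by rewrite activesS finset.subsetUl.
have stop s : (#|V| <= s)%N -> actives S b c s.+2 = actives S b c s.+1.
  move=> Vs; have [h|/existsNP[t /not_implyP[ts /contrapT e]]] :=
    pselect (forall t, (t < s)%N -> actives S b c t.+2 <> actives S b c t.+1).
    have := grow s h => sA.
    apply/eqP; rewrite eq_sym eqEcard activesS finset.subsetUl/=.
    by rewrite (leq_trans _ sA)// (leq_trans (max_card _)).
  have := actives_stable e => st.
  by rewrite -(subnK (ltnW ts)) -addSn !st.
move=> /subnK <-; elim: (tau - _)%N => [//|k IHk].
rewrite -IHk addSn addnS positivesS// stop//; exact: leq_addl.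
Qed.

(* Thresholds and sign coins, indexed by the enumeration of [V], are drawn
   independently and uniformly from [0, 1].  Those of seeds are never used. *)
Definition cube_val (x : #|V|.-tuple (measurableTypeR R)) (v : V) : R :=
  tnth x (enum_rank v).

Definition ltn_prob : probability
    (#|V|.-tuple (measurableTypeR R) * #|V|.-tuple (measurableTypeR R))%type R :=
  (cube_prob R #|V| \x cube_prob R #|V|)%E.

Definition fplus (S : {set V}) : \bar R :=
  ('E_ltn_prob[fun x =>
     #|final_positives S (cube_val x.1) (cube_val x.2)|%:R])%E.

End LTN.

(* Main.v *)
(* LT-N diffusion has the same law as a live-edge process: each node [v]
   independently selects at most one incoming edge, (u, v) with probability
   w(u, v), and independently a sign behaviour: positive with probability
   q+(v), negative with probability q-(v), and otherwise copying the node at the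
   other end of its live edge.  Indeed, for a fixed history (activation time and
   sign of every node), the event that the process follows this history is in
   both models a product over the nodes of events about their own randomness,
   and the factors agree: a node activated at step t contributes
   w(new) (q+ + (1 - r) w(newpos) / w(new)) = q+ w(new) + (1 - r) w(newpos).
   Once the live edges and sign behaviours are fixed, a node ends up positive if
   and only if the seed set meets a set that depends only on this configuration,
   so f+ is a nonnegative combination of coverage functions. *)
Require Import Defs.
From HB Require Import structures.
From mathcomp Require Import all_boot all_order all_algebra.
From mathcomp Require Import all_classical all_reals all_analysis.
From mathcomp Require Import measurable_realfun ring lra.

Set Implicit Arguments.
Unset Strict Implicit.
Unset Printing Implicit Defensive.

Import Order.TTheory GRing.Theory Num.Theory.
Local Open Scope ring_scope.

(** * Deterministic cascades and their histories *)

Section Cascade.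
Variable V : finType.
Local Notation state := ({set V} * {set V} * {set V})%type.
Implicit Types (S : {set V}) (D : V -> state -> option bool) (st : state).

(* States are triples (previously active, positive, negative).  [D v st] says
   whether and with which sign [v], if still inactive, is activated by [st]. *)
Definition active st : {set V} := st.1.2 :|: st.2.

Definition cascade_step D st : state :=
  (active st,
   st.1.2 :|: [set v in ~: active st | D v st == Some true],
   st.2 :|: [set v in ~: active st | D v st == Some false]).

Definition cascade D S k : state :=
  iter k (cascade_step D) (finset.set0, S, finset.set0).

Lemma cascadeS D S k :
  cascade D S k.+1 = cascade_step D (cascade D S k).
Proof. by []. Qed.

Section History.
Variable n : nat.
Local Notation history := {ffun V -> 'I_n.+2 * bool}.
Implicit Types (h : history) (s : nat -> state).

(* [h v] is the activation time of [v] and its sign; the time [n.+1] stands for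
   no activation by time [n], and comes with the junk sign [false]. *)
Definition history_state h k : state :=
  ([set v | (h v).1 < k]%N, [set v | ((h v).1 <= k)%N && (h v).2],
   [set v | ((h v).1 <= k)%N && ~~ (h v).2]).

Lemma active_history_state h k :
  active (history_state h k) = [set v | (h v).1 <= k]%N.
Proof.
by apply/setP => v; rewrite !inE; case: (_ <= _)%N => //; case: (h v).2.
Qed.

(* The behaviour of a node with rule [d] if the cascade goes through the states
   [s 0], [s 1], and so on. *)
Definition response S s (v : V) (d : state -> option bool) : 'I_n.+2 * bool :=
  if v \in S then (ord0, true) else
  let j := find (fun k => d (s k) != None) (iota 0 n) in
  (inord j.+1, (j < n)%N && (d (s j) == Some true)).

(** A reaction to state [k] takes effect at time [k.+1]. The case [k = n] encodes silence in all of
    the first [n] states, with the junk sign. *)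
Lemma responseP S s v d (t : 'I_n.+2) (e : bool) : v \notin S ->
  reflect (exists k : nat, [/\ t = k.+1 :> nat,
             (forall j, (j < k)%N -> d (s j) = None) &
             if (k < n)%N then d (s k) = Some e else e = false])
          ((t, e) == response S s v d).
Proof.
move=> /negbTE vS; rewrite /response vS.
set P : pred nat := (X in find X _); set j := find P _.
have jn : (j <= n)%N by rewrite -[leqRHS](size_iota 0) find_size.
have before i : (i < j)%N -> d (s i) = None.
  move=> ij; have := before_find 0 ij.
  by rewrite nth_iota ?add0n ?(leq_trans ij)//; rewrite /P => /negbFE/eqP.
have at_j : (j < n)%N -> d (s j) != None.
  move=> ltjn; have : has P (iota 0 n) by rewrite has_find size_iota.
  by move=> /(nth_find 0); rewrite nth_iota.
apply: (iffP eqP) => [[-> ->]|[k [tk lt_k at_k]]].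
  exists j; rewrite inordK ?ltnS//; split=> //.
  case: ltnP => // /at_j; case: (d (s j)) => [[]|]//.
have kn : (k <= n)%N by rewrite -ltnS -tk -ltnS.
have -> : j = k.
  case: (ssrnat.ltngtP j k) => // [jk|kj].
    by have := at_j (leq_trans jk kn); rewrite lt_k ?eqxx.
  by move: at_k; rewrite before// (leq_trans kj jn).
congr pair; first by apply: val_inj; rewrite /= inordK -?tk.
by move: at_k; case: ltnP => // _ ->; case: e.
Qed.

(* To be applied to [s := history_state h] and to [s := cascade D S]. *)
Lemma response_state D S s h :
    (forall k, (k < n)%N -> history_state h k = cascade D S k ->
       s k = cascade D S k) ->
    (forall v, h v = response S s v (D v)) ->
  forall k, (k <= n)%N -> history_state h k = cascade D S k.
Proof.
move=> hs hE; elim=> [_|k IHk kn].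
  have h0 v : ((h v).1 <= 0)%N = (v \in S).
    rewrite hE /response; case: ifP => //= _.
    by rewrite inordK// !ltnS -[leqRHS](size_iota 0) find_size.
  rewrite /history_state /cascade /=; congr (_, _, _); apply/setP => v;
    rewrite !inE ?ltn0 ?h0//.
    by rewrite hE /response; case: (v \in S).
  by rewrite hE /response; case: (v \in S).
have IH := IHk (ltnW kn); have sk := hs k kn IH.
rewrite cascadeS -{}IH in sk *.
(* A node recorded as inactive at [k] ignored all earlier states, so the recorded time is [k.+1]
   exactly when its rule fires at [s k], which is the cascade state. *)
have new v : ~~ ((h v).1 <= k)%N -> forall e,
    (((h v).1 <= k.+1)%N && ((h v).2 == e)) =
    (D v (history_state h k) == Some e).
  move=> hk e.
  have vS : v \notin S.
    by apply: contraNN hk => vS; rewrite hE /response vS.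
  have /(responseP _ _ _ _ vS) [j [tj ltj atj]] :
      ((h v).1, (h v).2) == response S s v (D v)
    by rewrite -hE -surjective_pairing.
  rewrite tj ltnS in hk *; rewrite -ltnNge ltnS in hk.
  move: hk; rewrite leq_eqVlt => /orP[/eqP kj|kj].
    rewrite -kj kn sk in atj *.
    by rewrite leqnn/= atj; apply/eqP/eqP => [->|[]].
  by rewrite leqNgt kj/= -sk ltj.
have old v : ((h v).1 <= k)%N -> ((h v).1 <= k.+1)%N by move/leq_trans; apply.
rewrite /cascade_step active_history_state; congr (_, _, _); apply/setP => v;
  rewrite !inE//; case: (boolP ((h v).1 <= k)%N) => [hk|hk]/=.
- by rewrite orbF old.
- by rewrite -new// eqb_id.
- by rewrite orbF old.
- by rewrite -new// eqbF_neg.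
Qed.

Definition trajectory D S : history :=
  [ffun v => response S (cascade D S) v (D v)].

Lemma trajectory_state D S k : (k <= n)%N ->
  history_state (trajectory D S) k = cascade D S k.
Proof. by apply: response_state => // v; rewrite ffunE. Qed.

Lemma eq_response S s s' v d : (forall k, (k < n)%N -> s k = s' k) ->
  response S s v d = response S s' v d.
Proof.
move=> ss; rewrite /response; case: ifP => // _.
rewrite (@eq_in_find _ _ (fun k => d (s' k) != None)); last first.
  by move=> k; rewrite mem_iota => /ss ->.
set j := find _ _; case: (ltnP j n) => [/ss ->//|].
by [].
Qed.

(* The joint event on the left is a conjunction of conditions each involving
   the randomness of a single node. *)
Lemma trajectoryE D S h : (trajectory D S == h) =
  [forall v, h v == response S (history_state h) v (D v)].
Proof.
apply/eqP/forallP => [<- v|hE].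
  apply/eqP; rewrite ffunE; apply: eq_response => k kn.
  by rewrite trajectory_state// ltnW.
have hst : forall k, (k <= n)%N -> history_state h k = cascade D S k.
  by apply: response_state (fun _ _ => id) _ => v; apply/eqP.
apply/ffunP => v; rewrite ffunE (eqP (hE v)); apply: eq_response => k kn.
by rewrite hst// ltnW.
Qed.

End History.
End Cascade.

(** * Threshold and coin events under the uniform law *)

Section Uniform.
Variable R : realType.
Local Notation realM := (measurableTypeR R).
Local Notation U := (uniform_prob (@ltr01 R)).

(** [BSide s] treats open and closed ends at once: coins are compared strictly, thresholds
    weakly. *)
Lemma uniform01_down (s : bool) (x : R) : 0 <= x <= 1 ->
  U [set` Interval -oo%O (BSide s x)]%classic = x%:E.
Proof.
move=> /andP[x0 x1]; rewrite /uniform_prob integral_uniform_pdf.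
set A := (_ `&` _)%classic.
have AE : A = [set` Interval (BLeft 0) (BSide s x)]%classic.
  rewrite /A; apply/seteqP; split => y /=; rewrite !in_itv/=.
    by move=> [-> /andP[-> _]].
  move=> /andP[-> yx]; split=> //=.
  by rewrite (le_trans (lteifW yx)).
transitivity (\int[lebesgue_measure]_(y in A) 1%:E)%E.
  apply: eq_integral => y /set_mem [_]; rewrite /= in_itv/= /uniform_pdf => ->.
  by rewrite subr0 invr1.
rewrite AE integral_cst// mul1e [LHS]lebesgue_measure_itv/= lte_fin.
by case: ltgtP x0 => // [_ _|<-]; rewrite ?sube0.
Qed.

(** The flag [k0] marks the initial state, where no earlier silence bounds the threshold from
    below. *)
Lemma betweenE (k0 : bool) (x y : R) :
  [set b | (k0 || (x < b)) && (b <= y)]%classic =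
  (`]-oo, y] `\` (if k0 then set0 else `]-oo, x]))%classic.
Proof.
apply/seteqP; split => b; case: k0; rewrite /= !in_itv/=; first by split.
- by move=> /andP[xb ->]; split=> //; apply/negP; rewrite -ltNge.
- by move=> [].
- by move=> [-> /negP]; rewrite -ltNge => ->.
Qed.

Lemma aboveE (k0 : bool) (x : R) :
  [set b | k0 || (x < b)]%classic =
  (~` (if k0 then set0 else `]-oo, x]))%classic.
Proof.
case: k0; first by rewrite setC0; apply/seteqP; split.
by rewrite setCitvl; apply/seteqP; split => b /=; rewrite in_itv/= andbT.
Qed.

Lemma coinE (e : bool) (p : R) :
  [set c | (c < p) == e]%classic =
  (if e then `]-oo, p[ else ~` `]-oo, p[)%classic.
Proof.
case: e; apply/seteqP; split => c /=; rewrite in_itv/= ?eqb_id ?eqbF_neg//.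
  by move=> /negP.
by move=> /negP.
Qed.

Lemma measurable_between (k0 : bool) (x y : R) :
  measurable ([set b | (k0 || (x < b)) && (b <= y)]%classic : set realM).
Proof. by rewrite betweenE; apply: measurableD => //; case: k0. Qed.

Lemma measurable_above (k0 : bool) (x : R) :
  measurable ([set b | k0 || (x < b)]%classic : set realM).
Proof. by rewrite aboveE; apply: measurableC; case: k0. Qed.

Lemma measurable_coin (e : bool) (p : R) :
  measurable ([set c | (c < p) == e]%classic : set realM).
Proof. by rewrite coinE; case: e => //; apply: measurableC. Qed.

Lemma uniform01_between (k0 : bool) (x y : R) : (k0 -> x = 0) ->
  0 <= x -> x <= y -> y <= 1 ->
  U [set b | (k0 || (x < b)) && (b <= y)]%classic = (y - x)%:E.
Proof.
move=> xE x0 xy y1.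
have Uy : U `]-oo, y]%classic = y%:E.
  by rewrite uniform01_down// y1 (le_trans x0).
rewrite betweenE; case: k0 xE => [->//|_]; first by rewrite setD0 Uy subr0.
rewrite measureD//=; last by rewrite Uy ltry.
rewrite setIidr; last by apply: subset_itvl; rewrite bnd_simp.
by rewrite Uy uniform01_down// x0 (le_trans xy).
Qed.

Lemma uniform01_above (k0 : bool) (x : R) : (k0 -> x = 0) ->
  0 <= x <= 1 ->
  U [set b | k0 || (x < b)]%classic = (1 - x)%:E.
Proof.
move=> xE x01; rewrite aboveE.
case: k0 xE => [->//|_]; first by rewrite setC0 probability_setT subr0.
by rewrite probability_setC//= uniform01_down.
Qed.

Lemma uniform01_coin (e : bool) (p : R) : 0 <= p <= 1 ->
  U [set c | (c < p) == e]%classic = (if e then p else 1 - p)%:E.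
Proof.
move=> p01; rewrite coinE.
by case: e; rewrite ?probability_setC//= uniform01_down.
Qed.

Lemma measurable_box (m : nat) (B : 'I_m -> set realM) :
  (forall i, measurable (B i)) ->
  measurable ([set x | forall i, B i (tnth x i)]%classic :
    set (m.-tuple realM)).
Proof.
move=> mB.
rewrite [X in measurable X](_ : _ = (\bigcap_(i in [set: 'I_m]%classic)
    ((fun x : m.-tuple realM => tnth x i) @^-1` B i))%classic).
  apply: fin_bigcap_measurable => // i _; rewrite -[X in measurable X]setTI.
  exact: (@measurable_tnth _ realM m i).
by apply/seteqP; split=> x /= h i; [move=> _|]; exact: h.
Qed.

End Uniform.

Lemma big_option (R : nmodType) (T : finType) (F : option T -> R) :
  \sum_x F x = F None + \sum_x F (Some x).
Proof.
rewrite (bigD1 None)//=; congr (_ + _).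
rewrite (reindex_omap Some id)/=; last by case.
by apply: eq_bigl => x; rewrite eqxx.
Qed.

(** * The two activation rules *)

Section Rules.
Variables (R : realType) (V : finType) (E : rel V).
Variables (w : V -> V -> R) (qp qm : V -> R).

Definition threshold_rule (v : V) (x : R * R)
    (st : {set V} * {set V} * {set V}) : option bool :=
  if x.1 <= inweight E w (active st) v
  then Some (x.2 < pos_prob E w qp qm st.1.1 st.1.2 st.2 v) else None.

(** Cascade time 0 is the seeding step 1 of the diffusion, hence the shift. *)
Lemma ltn_state_cascade S b c k :
  ltn_state E w qp qm S b c k.+1 =
  cascade (fun v => threshold_rule v (b v, c v)) S k.
Proof.
elim: k => [//|k IHk]; rewrite ltn_stateSS IHk /cascade iterS.
case: (iter _ _ _) => -[prev pos] neg; rewrite /ltn_step /cascade_step.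
congr (_, _, _); apply/setP => v; rewrite !inE /threshold_rule /=;
  rewrite /active /=; case: (v \in pos); case: (v \in neg) => //=;
  by case: (b v <= _) => //=; case: (c v < _).
Qed.

(* [a.1] is the node on the other end of the live edge into the node, if any;
   [a.2] is the sign the node takes autonomously, [None] if it takes over the
   sign of [a.1]. *)
Definition live_edge_rule (a : option V * option bool)
    (st : {set V} * {set V} * {set V}) : option bool :=
  if a.1 is Some u then
    if u \in active st then Some (odflt (u \in st.1.2) a.2) else None
  else None.

(** Live edge and sign behaviour are independent. The values of [w] off the edges are arbitrary, so
    non-edges get weight 0 explicitly. *)
Definition live_edge_weight (v : V) (a : option V * option bool) : R :=
  (match a.1 with
   | Some u => if E u v then w u v else 0
   | None => 1 - \sum_(u in Nin E v) w u v
   end) *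
  (match a.2 with
   | Some true => qp v
   | Some false => qm v
   | None => 1 - rfac qp qm v
   end).

(** Sums out both choices of a node: [P] constrains the live parent, [g] the sign behaviour, and the
    outcome without a live edge contributes nothing. *)
Lemma sum_live_edge (v : V) (P : pred V) (g : V -> option bool -> bool) :
  \sum_a live_edge_weight v a *
     (nat_of_bool (if a.1 is Some u then P u && g u a.2 else false))%:R =
  \sum_(u in Nin E v | P u) w u v *
    (qp v * (g u (Some true))%:R + qm v * (g u (Some false))%:R +
       (1 - rfac qp qm v) * (g u None)%:R).
Proof.
rewrite -(pair_bigA _ (fun p s => live_edge_weight v (p, s) *
  (nat_of_bool (if p is Some u then P u && g u s else false))%:R))/=.
rewrite big_option big1 ?add0r => [|s _]; last by rewrite mulr0.
rewrite [RHS]big_mkcond; apply: eq_bigr => u _.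
rewrite !inE big_option big_bool /live_edge_weight/=.
by case: (E u v); case: (P u) => //=; ring.
Qed.

Lemma sum_live_edge_weight v : \sum_a live_edge_weight v a = 1.
Proof.
rewrite -(pair_bigA _ (fun p s => live_edge_weight v (p, s)))/=.
under eq_bigr do rewrite big_option big_bool /live_edge_weight/= -!mulrDr.
rewrite -mulr_suml big_option -big_mkcond/=.
rewrite /rfac (eq_bigl (fun u => E u v)); last by move=> u; rewrite inE.
by ring.
Qed.

End Rules.

(** * Probability that one node follows a given history, in both models *)

Section Factor.
Variables (R : realType) (V : finType) (E : rel V).
Variables (w : V -> V -> R) (qp qm : V -> R).
Hypotheses (w_ge0 : forall u v : V, E u v -> 0 <= w u v)
  (w_le1 : forall v : V, \sum_(u in Nin E v) w u v <= 1)
  (qp_ge0 : forall v : V, 0 <= qp v)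
  (qm_ge0 : forall v : V, 0 <= qm v)
  (q_le1 : forall v : V, qp v + qm v <= 1).
Local Notation realM := (measurableTypeR R).
Local Notation U := (uniform_prob (@ltr01 R)).
Local Notation inw := (inweight E w).

Lemma live_edge_weight_ge0 v a : 0 <= live_edge_weight E w qp qm v a.
Proof.
rewrite /live_edge_weight; apply: mulr_ge0.
  by case: a.1 => [u|]; [case: ifP => // /w_ge0|rewrite subr_ge0].
by case: a.2 => [[]|]; rewrite /rfac ?subr_ge0.
Qed.

Lemma inweight0 v : inw finset.set0 v = 0.
Proof. by rewrite /inweight finset.setI0 big_set0. Qed.

Lemma inweight_setD (A B : {set V}) v : A \subset B ->
  inw (B :\: A) v = inw B v - inw A v.
Proof.
move=> AB; rewrite /inweight [in RHS](big_setID A)/= -finset.setIA.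
by rewrite (finset.setIidPr AB) -finset.setIDA addrC addrK.
Qed.

Lemma inweight_ge0 (A : {set V}) v : 0 <= inw A v.
Proof. by apply: sumr_ge0 => u; rewrite !inE => /andP[/w_ge0]. Qed.

Lemma inweight_le (A B : {set V}) v : A \subset B -> inw A v <= inw B v.
Proof. by move=> AB; rewrite -subr_ge0 -inweight_setD// inweight_ge0. Qed.

Lemma inweight_le1 (A : {set V}) v : inw A v <= 1.
Proof.
rewrite (le_trans (inweight_le v (finset.subsetT A)))//.
by rewrite /inweight finset.setIT.
Qed.

Lemma inweight_le01 (A : {set V}) v : 0 <= inw A v <= 1.
Proof. by rewrite inweight_ge0 inweight_le1. Qed.

Lemma pos_prob_le01 (prev pos neg : {set V}) v :
  0 <= pos_prob E w qp qm prev pos neg v <= 1.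
Proof.
rewrite /pos_prob /rfac; set x := inw _ _; set y := inw _ _.
have x0 : 0 <= x by exact: inweight_ge0.
have y0 : 0 <= y by exact: inweight_ge0.
have xy : x <= y by apply/inweight_le/finset.setSD/finset.subsetUl.
have q0 : 0 <= 1 - (qp v + qm v) by rewrite subr_ge0.
have r0 : 0 <= x / y by exact: divr_ge0.
have r1 : x / y <= 1.
  have [->|y_neq0] := eqVneq y 0; first by rewrite invr0 mulr0.
  by rewrite ler_pdivrMr ?mul1r// lt_def y_neq0.
apply/andP; split; first by rewrite addr_ge0// mulr_ge0.
have := ler_wpM2l q0 r1; rewrite mulr1.
have := qm_ge0 v; lra.
Qed.

(** When the denominator of [pos_prob] vanishes, so does the weight of the new positive nodes, and
    both sides are 0; the convention for the quotient is harmless. *)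
Lemma pos_probM (prev pos neg : {set V}) v :
  inw ((pos :|: neg) :\: prev) v * pos_prob E w qp qm prev pos neg v =
  qp v * inw ((pos :|: neg) :\: prev) v +
  (1 - rfac qp qm v) * inw (pos :\: prev) v.
Proof.
rewrite /pos_prob; set x := inw _ _; set y := inw (pos :\: _) _.
have [x0|x_neq0] := eqVneq x 0; last by field.
suff -> : y = 0 by rewrite x0; ring.
apply/le_anti; rewrite inweight_ge0 -{1}x0 andbT.
by apply/inweight_le/finset.setSD/finset.subsetUl.
Qed.

Section FixedHistory.
Variables (n : nat) (S : {set V}) (h : {ffun V -> 'I_n.+2 * bool}) (v : V).

(* The probability that node [v] acts as recorded in [h], when all the other
   nodes act as recorded in [h]; the same in both models. *)
Definition history_factor : R :=
  if v \in S then (h v == (ord0, true))%:R else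
  if val (h v).1 is k.+1 then
    let: (prev, pos, neg) := history_state h k in
    if (k < n)%N then
      inw ((pos :|: neg) :\: prev) v *
        (if (h v).2 then pos_prob E w qp qm prev pos neg v
         else 1 - pos_prob E w qp qm prev pos neg v)
    else if (h v).2 then 0 else 1 - inw prev v
  else 0.

Local Notation st := (history_state h).

Lemma prev_sub_active k : (st k).1.1 \subset active (st k).
Proof.
rewrite active_history_state; apply/fintype.subsetP => u.
by rewrite !inE; exact: ltnW.
Qed.

(** The rule fires once the live parent is active, and activity only grows, so silence before [k]
    depends only on the previously active set at [k], empty for [k = 0]. *)
Lemma live_edge_silent (a : option V * option bool) k :
  (forall j, (j < k)%N -> live_edge_rule a (st j) = None) <->
  ~~ (if a.1 is Some u then u \in (st k).1.1 else false).
Proof.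
rewrite /live_edge_rule; case: a.1 => [u|//].
split=> [hj|uk j jk].
  rewrite inE -leqNgt leqNgt; apply/negP => uk.
  have k0 : (0 < k)%N by case: k uk {hj}.
  have := hj k.-1; rewrite prednK// leqnn active_history_state inE.
  by rewrite -ltnS prednK// uk => /(_ isT).
rewrite active_history_state inE ifN//.
by apply: contraNN uk => uj; rewrite inE (leq_ltn_trans uj).
Qed.

(** An activation recorded after state [k] means that the live parent is among the nodes new at [k]
    and that autonomy or copying yields the recorded sign. Summing over these parents gives
    [pos_prob] with its denominator cleared. *)
Lemma live_edge_factor :
  \sum_a live_edge_weight E w qp qm v a *
    (h v == response n S st v (live_edge_rule a))%:R = history_factor.
Proof.
rewrite /history_factor; case: ifPn => vS.
  under eq_bigr do rewrite /response vS.
  by rewrite -mulr_suml sum_live_edge_weight mul1r.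
case hv: (h v) => [t e] /=.
case tE: (nat_of_ord t) => [|k].
  rewrite big1// => a _; case: responseP => //; last by rewrite mulr0.
  by move=> [k []]; rewrite tE.
have kn : (k <= n)%N by rewrite -ltnS -tE -ltnS.
set d := fun a => (t, e) == response n S st v (live_edge_rule a).
have dP a : reflect (~~ (if a.1 is Some u then u \in (st k).1.1 else false) /\
     if (k < n)%N then live_edge_rule a (st k) = Some e else e = false) (d a).
  apply: (iffP (responseP _ _ _ _ vS)) => [[k' []]|[ak ek]].
    by rewrite tE => -[<-] /live_edge_silent.
  by exists k; split=> //; apply/live_edge_silent.
case: ltnP => [ltkn|nk].
  under eq_bigr => a _.
    rewrite -/(d a); have -> : d a = (if a.1 is Some u then
        (u \in active (st k) :\: (st k).1.1) &&
        (odflt (u \in (st k).1.2) a.2 == e) else false).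
      apply/dP/idP; rewrite ltkn /live_edge_rule.
        case: a.1 => [u [up]|[]//].
        by rewrite finset.in_setD up; case: ifP => // _ [->]; rewrite eqxx.
      by case: a.1 => [u|//]; rewrite finset.in_setD;
        move=> /andP[/andP[-> ->] /eqP ->].
    over.
  rewrite (sum_live_edge _ _ _ _ _ (fun u => u \in active (st k) :\: (st k).1.1)
    (fun u s => odflt (u \in (st k).1.2) s == e)).
  set new := _ :\: _.
  have posE : \sum_(u in Nin E v | u \in new)
      w u v * (qp v + (1 - rfac qp qm v) * (u \in (st k).1.2)%:R) =
      inw new v * pos_prob E w qp qm (st k).1.1 (st k).1.2 (st k).2 v.
    rewrite pos_probM.
    have sum_in (A : {set V}) : inw A v =
        \sum_(u in Nin E v) w u v * (u \in A)%:R.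
      rewrite /inweight [RHS]big_mkcond [LHS]big_mkcond; apply: eq_bigr => u _.
      by rewrite !inE; case: (E u v); case: (u \in A); rewrite ?mulr1 ?mulr0.
    rewrite !sum_in !mulr_sumr -big_split/= [LHS]big_mkcondr/=.
    apply: eq_bigr => u _; rewrite /new /active !inE.
    by case: (_ < _)%N; case: (_ <= _)%N; case: (h u).2 => //=; ring.
  have newE : \sum_(u in Nin E v | u \in new) w u v = inw new v.
    by rewrite /inweight; apply: eq_bigl => u; rewrite !inE.
  case: e {hv d dP} => /=.
    by rewrite -posE; apply: eq_bigr => u _; case: (u \in _); rewrite /=; ring.
  (* The negative sign is the complement, since [qp v + qm v + (1 - rfac qp qm v) = 1]. *)
  rewrite mulrBr [X in _ = X - _]mulr1 -posE -newE -sumrB.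
  apply: eq_bigr => u _.
  by rewrite /rfac !inE; case: (_ && _); rewrite /=; ring.
(* Here [k = n]: the node stays inactive throughout, so its live parent, if any, is not among the
   nodes active before time [n]. *)
rewrite ltnNge nk /= in dP.
have dE a : (d a)%:R = (~~ e)%:R * (1 - (nat_of_bool (if a.1 is Some u then
    (u \in (st k).1.1) && true else false))%:R) :> R.
  have -> : d a =
      ~~ (if a.1 is Some u then u \in (st k).1.1 else false) && ~~ e.
    by apply/dP/andP => [[-> ->]|[-> /negbTE ->]].
  by case: a.1 => [u|]; case: e {hv d dP}; rewrite ?andbT ?andbF;
    try case: (u \in _); rewrite /=; ring.
under eq_bigr do rewrite -/(d _) dE mulrCA mulrBr mulr1.
rewrite -mulr_sumr sumrB sum_live_edge_weight.
rewrite (sum_live_edge _ _ _ _ _ (fun u => u \in (st k).1.1) (fun _ _ => true)).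
case: e {hv d dP dE} => /=; first by rewrite mul0r.
rewrite mul1r /inweight; congr (_ - _).
rewrite [LHS]big_mkcondr [RHS]big_mkcond/=.
rewrite big_mkcond; apply: eq_bigr => u _; rewrite !inE.
by case: (E u v); case: (_ < _)%N; rewrite /= /rfac ?andbF//=; ring.
Qed.

(** Active sets grow, hence so does the incoming weight, and only the comparison at the last state
    before [k] matters; there is none for [k = 0]. *)
Lemma threshold_silent x k :
  (forall j, (j < k)%N -> threshold_rule E w qp qm v x (st j) = None) <->
  (k == 0%N) || (inw (st k).1.1 v < x.1).
Proof.
rewrite /threshold_rule; case: k => [|k]/=; first by split.
split=> [/(_ k (ltnSn k))|xk j jk].
  by rewrite active_history_state; case: (leP x.1) => // xk _; exact: xk.
rewrite active_history_state leNgt (le_lt_trans _ xk)//.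
apply/inweight_le/fintype.subsetP => u.
by rewrite !inE => /leq_ltn_trans; apply.
Qed.

(** Activation confines the threshold to the gap between the active weights of two consecutive
    states; the sign puts the coin on one side of [pos_prob]. These conditions concern independent
    variables, so the probabilities multiply. *)
Lemma threshold_factor : exists BC : set realM * set realM,
  [/\ measurable BC.1, measurable BC.2,
      forall x, h v = response n S st v (threshold_rule E w qp qm v x) <->
                BC.1 x.1 /\ BC.2 x.2 &
      (U BC.1 * U BC.2 = history_factor%:E)%E].
Proof.
rewrite /history_factor; case: ifPn => vS.
  have respE d : response n S st v d = (ord0, true) by rewrite /response vS.
  case: eqP => hv.
    exists (setT, setT); split=> /= [||x|].
    - exact: measurableT.
    - exact: measurableT.
    - by rewrite respE.
    - by rewrite !probability_setT mule1.
  exists (set0, set0); split=> /= [||x|].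
  - exact: measurable0.
  - exact: measurable0.
  - by rewrite respE; split=> // -[].
  - by rewrite measure0 mul0e.
case hv: (h v) => [t e] /=.
case tE: (nat_of_ord t) => [|k].
  exists (set0, set0); split=> /= [||x|].
  - exact: measurable0.
  - exact: measurable0.
  - split=> [/eqP/(responseP _ _ _ _ vS)[k []]|[]//]; by rewrite tE.
  - by rewrite measure0 mul0e.
have kn : (k <= n)%N by rewrite -ltnS -tE -ltnS.
have dP x : (t, e) = response n S st v (threshold_rule E w qp qm v x) <->
    ((k == 0%N) || (inw (st k).1.1 v < x.1)) /\
    if (k < n)%N then threshold_rule E w qp qm v x (st k) = Some e
    else e = false.
  split=> [/eqP/(responseP _ _ _ _ vS)[k' []]|[ak ek]].
    by rewrite tE => -[<-] /threshold_silent.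
  apply/eqP/(responseP _ _ _ _ vS); exists k.
  by split=> //; apply/threshold_silent.
(* With weight 0 at the initial state, the missing lower bound leaves the probability unchanged, so
   one formula covers all times. *)
have k0 : k == 0%N -> inw (st k).1.1 v = 0.
  move=> /eqP ->; have -> : (st 0).1.1 = finset.set0; last exact: inweight0.
  by apply/finset.setP => u; rewrite !inE.
have [ltkn|nk] := ltnP k n.
  rewrite ltkn in dP.
  set p := pos_prob E w qp qm (st k).1.1 (st k).1.2 (st k).2 v.
  exists ([set b | ((k == 0%N) || (inw (st k).1.1 v < b)) &&
            (b <= inw (active (st k)) v)], [set c | (c < p) == e])%classic.
  split=> /=; [exact: measurable_between|exact: measurable_coin|move=> x|].
    rewrite dP /threshold_rule; case: (_ <= _); rewrite ?andbT ?andbF.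
      by split=> -[-> pe]; split=> //; [case: pe => /eqP|move: pe => /eqP <-].
    by split=> -[].
  rewrite uniform01_between ?inweight_ge0 ?inweight_le1//; last first.
    exact/inweight_le/prev_sub_active.
  by rewrite uniform01_coin ?pos_prob_le01// -inweight_setD ?prev_sub_active.
rewrite ltnNge nk/= in dP.
exists ([set b | (k == 0%N) || (inw (st k).1.1 v < b)],
        if e then set0 else setT)%classic.
split=> /= [|||]; first exact: measurable_above.
- by case: (e).
- by move=> x; rewrite dP; case: (e); split=> -[].
rewrite uniform01_above ?inweight_le01//; case: (e).
  by rewrite measure0 mule0.
by rewrite probability_setT mule1.
Qed.

End FixedHistory.
End Factor.

(** * Equality of expectations in the two models *)

Section Expect.
Variables (R : realType) (V : finType) (E : rel V).
Variables (w : V -> V -> R) (qp qm : V -> R).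
Hypotheses (w_ge0 : forall u v : V, E u v -> 0 <= w u v)
  (w_le1 : forall v : V, \sum_(u in Nin E v) w u v <= 1)
  (qp_ge0 : forall v : V, 0 <= qp v)
  (qm_ge0 : forall v : V, 0 <= qm v)
  (q_le1 : forall v : V, qp v + qm v <= 1).
Local Notation realM := (measurableTypeR R).
Local Notation n := #|V|.
Local Notation history := {ffun V -> 'I_n.+2 * bool}.

Definition sample_rule (x : n.-tuple realM * n.-tuple realM) (v : V) :=
  threshold_rule E w qp qm v (cube_val x.1 v, cube_val x.2 v).

Definition history_event (S : {set V}) (h : history) :
    set (n.-tuple realM * n.-tuple realM) :=
  [set x | trajectory n (sample_rule x) S == h]%classic.

(** For fixed [h], [trajectoryE] decouples the nodes, so the event is a box of thresholds times a
    box of coins and its measure factorizes. *)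
Lemma history_event_prob S h : measurable (history_event S h) /\
  ltn_prob R V (history_event S h) =
    (\prod_v history_factor E w qp qm S h v)%:E.
Proof.
have [BC hBC] := choice (threshold_factor w_ge0 w_le1 qp_ge0 qm_ge0 q_le1 S h).
pose B (i : 'I_n) := (BC (enum_val i)).1.
pose C (i : 'I_n) := (BC (enum_val i)).2.
have eventE : history_event S h =
    ([set x | forall i, B i (tnth x i)] `*`
     [set x | forall i, C i (tnth x i)])%classic.
  apply/seteqP; split=> x; rewrite /history_event /= trajectoryE.
    move=> /forallP hx; split=> i; have [_ _ hv _] := hBC (enum_val i);
      have /eqP/hv[/=] := hx (enum_val i); by rewrite /cube_val enum_valK.
  move=> [x1 x2]; apply/forallP => v; apply/eqP.
  have [_ _ hv _] := hBC v; apply/hv; split=> /=.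
    by have := x1 (enum_rank v); rewrite /B enum_rankK.
  by have := x2 (enum_rank v); rewrite /C enum_rankK.
have mB i : measurable (B i) by have [] := hBC (enum_val i).
have mC i : measurable (C i) by have [] := hBC (enum_val i).
rewrite eventE; split; first by apply: measurableX; exact: measurable_box.
rewrite /ltn_prob [LHS]product_measure1E;
  [|exact: measurable_box|exact: measurable_box].
rewrite [X in (X * _)%E]cube_prob_box// [X in (_ * X)%E]cube_prob_box//.
rewrite -big_split/= -prodEFin.
rewrite [RHS](reindex (@enum_val V V)); last exact: onW_bij (enum_val_bij V).
by apply: eq_bigr => i _; have [] := hBC (enum_val i).
Qed.

Lemma fplus_history S : fplus E w qp qm S =
  (\sum_(h : history) #|(history_state h n).1.2|%:R *
     \prod_v history_factor E w qp qm S h v)%:E.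
Proof.
rewrite /fplus unlock.
(* The history events partition the sample space, and cascade time [n] is diffusion step [#|V|.+1],
   the one used by [final_positives]. *)
transitivity (\int[ltn_prob R V]_x \sum_(h : history)
    ((#|(history_state h n).1.2|%:R)%:E * (\1_(history_event S h) x)%:E))%E.
  apply: eq_integral => x _.
  rewrite (bigD1 (trajectory n (sample_rule x) S))// big1 ?adde0 => [|h hN].
    have xh : history_event S (trajectory n (sample_rule x) S) x by exact: eqxx.
    rewrite indicE (mem_set xh) mule1.
    rewrite trajectory_state// /final_positives /positives ltn_state_cascade.
    by rewrite [RHS]adde0.
  rewrite indicE memNset ?mule0// /history_event/= => /eqP hE.
  by move: hN; rewrite -hE eqxx.
have mE h : measurable (history_event S h) by have [] := history_event_prob S h.
rewrite ge0_integral_sum//; last first.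
  move=> h; apply: emeasurable_funM => //.
  by apply/measurable_EFinP; exact: measurable_indic.
rewrite -sumEFin; apply: eq_bigr => h _.
rewrite ge0_integralZl//; last first.
  by apply/measurable_EFinP; exact: measurable_indic.
rewrite integral_indic// setIT EFinM; congr (_ * _)%E.
exact: (history_event_prob S h).2.
Qed.

(** Each factor is a sum over the choices of one node; distributing the product over these sums
    joins the choices into a configuration [phi]. For fixed [phi] the indicators select a single
    history, its trajectory. *)
Lemma sum_history_factor S (g : history -> R) :
  \sum_h g h * \prod_v history_factor E w qp qm S h v =
  \sum_(phi : {ffun V -> option V * option bool})
    (\prod_v live_edge_weight E w qp qm v (phi v)) *
    g (trajectory n (fun v => live_edge_rule (phi v)) S).
Proof.
under eq_bigr => h _.
  under eq_bigr do rewrite -live_edge_factor//.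
  rewrite bigA_distr_bigA/= mulr_sumr.
  under eq_bigr => phi _.
    rewrite big_split/= -natr_prod mulrCA.
    over.
  over.
rewrite exchange_big/=; apply: eq_bigr => phi _.
rewrite -mulr_sumr; congr (_ * _).
set traj := trajectory _ _ _.
have trajE (h : history) : (\prod_v (h v == response n S (history_state h) v
    (live_edge_rule (phi v))) = (traj == h))%N.
  rewrite trajectoryE.
  case: (boolP [forall v, _]) => [/forallP hv|/forallPn[v hv]].
    by rewrite big1// => v _; rewrite hv.
  by rewrite (bigD1 v)//= (negbTE hv).
rewrite (bigD1 traj)//= trajE eqxx mulr1 big1 ?addr0// => h.
by rewrite trajE eq_sym => /negbTE ->; rewrite mulr0.
Qed.

Lemma fplus_live_edge S : fplus E w qp qm S =
  (\sum_(phi : {ffun V -> option V * option bool})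
     (\prod_v live_edge_weight E w qp qm v (phi v)) *
     #|(cascade (fun v => live_edge_rule (phi v)) S n).1.2|%:R)%:E.
Proof.
rewrite fplus_history sum_history_factor; congr EFin.
by apply: eq_bigr => phi _; rewrite trajectory_state.
Qed.

End Expect.

(** * Coverage functions *)

Section Meets.
Variable V : finType.
Implicit Types (S A B T : {set V}).

Definition meets S T := [exists u in S, u \in T].

Lemma meetsU1 S T v : meets S (v |: T) = (v \in S) || meets S T.
Proof.
apply/exists_inP/orP => [[u uS]|[vS|/exists_inP[u uS uT]]].
- rewrite !inE => /orP[/eqP <-|uT]; first by left.
  by right; apply/exists_inP; exists u.
- by exists v; rewrite // !inE eqxx.
- by exists u; rewrite // !inE uT orbT.
Qed.

Lemma meets_set0 S : meets S finset.set0 = false.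
Proof. by apply/exists_inP => -[u _]; rewrite inE. Qed.

Lemma meetsU S A T : meets (S :|: A) T = meets S T || meets A T.
Proof.
apply/exists_inP/orP => [[u + uT]|[]/exists_inP[u uS uT]].
- by rewrite inE => /orP[uS|uA]; [left|right]; apply/exists_inP; exists u.
- by exists u; rewrite // inE uS.
- by exists u; rewrite // inE uS orbT.
Qed.

Lemma meets_sub A B T : A \subset B -> meets A T -> meets B T.
Proof. by move=> /finset.setUidPr <-; rewrite meetsU => ->. Qed.

(** Adding [v] to [B] gains only if [v] lies in [T] and [B] misses [T]; then the smaller [A] misses
    [T] too and gains as much. *)
Lemma meets_submodular (R : realType) A B T v :
  A \subset B ->
  (meets (v |: B) T)%:R - (meets B T)%:R <=
  (meets (v |: A) T)%:R - (meets A T)%:R :> R.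
Proof.
move=> AB; have : meets A T -> meets B T by exact: meets_sub.
rewrite !meetsU.
case: (meets [set v] T); case: (meets A T); case: (meets B T) => //=; try lra.
Qed.

End Meets.

(** * Live-edge outcomes as coverage *)

Section Coverage.
Variables (V : finType) (phi : V -> option V * option bool).
Implicit Types (S T : {set V}).
Local Notation cas S k := (cascade (fun v => live_edge_rule (phi v)) S k).

Lemma live_edge_active S k v : (v \in active (cas S k.+1)) =
  (v \in active (cas S k)) ||
  (if (phi v).1 is Some u then u \in active (cas S k) else false).
Proof.
rewrite cascadeS /cascade_step /active /= !inE /live_edge_rule /active.
set st := cascade _ _ _.
case: (v \in st.1.2); case: (v \in st.2) => //=.
case: (phi v) => -[u|//] s /=; rewrite finset.in_setU.
by case: (u \in st.1.2); case: (u \in st.2); case: s => [[]|].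
Qed.

Lemma active_mono S k : active (cas S k) \subset active (cas S k.+1).
Proof. by apply/fintype.subsetP => v vk; rewrite live_edge_active vk. Qed.

Lemma seed_positive S k v : v \in S -> v \in (cas S k).1.2.
Proof.
by move=> vS; elim: k => [//|k IHk]; rewrite cascadeS finset.in_setU IHk.
Qed.

Lemma positive_active S k v : v \in (cas S k).1.2 -> v \in active (cas S k).
Proof. by rewrite inE => ->. Qed.

Lemma positiveS_active S k v : v \in active (cas S k) ->
  (v \in (cas S k.+1).1.2) = (v \in (cas S k).1.2).
Proof.
move=> vk; rewrite cascadeS finset.in_setU finset.in_set.
by rewrite finset.in_setC vk orbF.
Qed.

Lemma positiveS_new S k v : v \notin active (cas S k) ->
  (v \in (cas S k.+1).1.2) =
  (if (phi v).1 is Some u then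
     (u \in active (cas S k)) && odflt (u \in (cas S k).1.2) (phi v).2
   else false).
Proof.
move=> vk; rewrite cascadeS finset.in_setU.
have /negbTE -> : v \notin (cas S k).1.2.
  by apply: contraNN vk => /positive_active.
rewrite finset.in_set finset.in_setC vk/= /live_edge_rule.
case: (phi v).1 => [u|//].
by case: ifP => //= _; case: (odflt _ _).
Qed.

(* Signs never change, so the node still agrees with the sign its parent had
   when the node was activated. *)
Lemma live_edge_parent S k v : v \in active (cas S k) -> v \notin S ->
  if (phi v).1 is Some u then
    u \in active (cas S k) /\
    (v \in (cas S k).1.2) = odflt (u \in (cas S k).1.2) (phi v).2
  else False.
Proof.
move=> + vS; elim: k => [|k IHk].
  by rewrite !inE (negbTE vS).
have [vk _|vk] := boolP (v \in active (cas S k)).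
  move: (IHk vk); case: (phi v).1 => [u [uk e]|//].
  by rewrite !positiveS_active// (fintype.subsetP (active_mono _ _)).
rewrite live_edge_active (negbTE vk)/= positiveS_new//.
case: (phi v).1 => [u uk|//].
by rewrite uk (positiveS_active uk) (fintype.subsetP (active_mono _ _)).
Qed.

(** An active non-seed has an active live parent, so the earlier status of [v] drops out, leaving a
    recursion along live edges. *)
Lemma live_edge_activeE S k v : (v \in active (cas S k.+1)) =
  (v \in S) || (if (phi v).1 is Some u then u \in active (cas S k) else false).
Proof.
have [vS|vS] := boolP (v \in S).
  by rewrite (positive_active (seed_positive _ vS)).
rewrite orFb.
rewrite live_edge_active; have [vk|//] := boolP (v \in _).
by have := live_edge_parent vk vS; case: (phi v).1 => [u []|//].
Qed.

(** By [live_edge_parent], a non-seed that is already active obeys the same formula as a newly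
    activated one. *)
Lemma live_edge_positiveE S k v : (v \in (cas S k.+1).1.2) =
  (v \in S) || (if (phi v).1 is Some u then
    match (phi v).2 with
    | Some s => s && (u \in active (cas S k))
    | None => u \in (cas S k).1.2
    end else false).
Proof.
have [vS|vS] := boolP (v \in S); first by rewrite seed_positive.
rewrite orFb.
have [vk|vk] := boolP (v \in active (cas S k)).
  rewrite positiveS_active//; have := live_edge_parent vk vS.
  case: (phi v).1 => [u [uk ->]|//]; rewrite uk.
  by case: (phi v).2 => [[]|].
rewrite positiveS_new//; case: (phi v).1 => [u|//].
case: (phi v).2 => [s|]/=; first by rewrite andbC.
by apply: andb_idl; exact: positive_active.
Qed.

(** [T] collects the nodes on the backward live-edge path from [v], up to [k] edges long. *)
Lemma active_coverage k v : exists T, forall S,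
  (v \in active (cas S k)) = meets S T.
Proof.
elim: k v => [|k IHk] v.
  exists (v |: finset.set0) => S.
  by rewrite meetsU1 meets_set0 /active/= finset.setU0 orbF.
case pv: (phi v).1 => [u|].
  have [T uT] := IHk u.
  by exists (v |: T) => S; rewrite live_edge_activeE pv meetsU1 uT.
exists (v |: finset.set0) => S.
by rewrite live_edge_activeE pv meetsU1 meets_set0.
Qed.

(* Follow the live edges backwards from [v]: the set consists of all nodes met
   on the way, up to the first autonomously negative node if that is the first
   autonomous one. *)
Lemma positive_coverage k v : exists T, forall S,
  (v \in (cas S k).1.2) = meets S T.
Proof.
elim: k v => [|k IHk] v.
  by exists (v |: finset.set0) => S; rewrite meetsU1 meets_set0 orbF.
(* Without a live edge, or with an autonomous negative sign, [v] is positive only as a seed. *)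
have triv : (forall S, (v \in (cas S k.+1).1.2) = (v \in S)) ->
    exists T, forall S, (v \in (cas S k.+1).1.2) = meets S T.
  move=> hS; exists (v |: finset.set0) => S.
  by rewrite meetsU1 meets_set0 hS orbF.
case pv: (phi v) => [[u|] [[]|]];
  try by apply: triv => S; rewrite live_edge_positiveE pv/= orbF.
  have [T uT] := active_coverage k u.
  by exists (v |: T) => S; rewrite live_edge_positiveE pv/= meetsU1 uT.
have [T uT] := IHk u.
by exists (v |: T) => S; rewrite live_edge_positiveE pv/= meetsU1 uT.
Qed.

Lemma card_positive_coverage (R : realType) k :
  exists F : V -> {set V}, forall S,
  #|(cas S k).1.2|%:R = \sum_v (meets S (F v))%:R :> R.
Proof.
have [F hF] := choice (positive_coverage k); exists F => S.
rewrite -sum1_card natr_sum big_mkcond; apply: eq_bigr => v _.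
by rewrite -hF; case: (_ \in _).
Qed.

End Coverage.

Theorem theorem1 (R : realType) (V : finType) (E : rel V)
    (w : V -> V -> R) (qp qm : V -> R)
    (w_ge0 : forall u v : V, E u v -> 0 <= w u v)
    (w_le1 : forall v : V, \sum_(u in Nin E v) w u v <= 1)
    (qp_ge0 : forall v : V, 0 <= qp v)
    (qm_ge0 : forall v : V, 0 <= qm v)
    (q_le1 : forall v : V, qp v + qm v <= 1) :
  let f := fplus E w qp qm in
  (forall A B : {set V}, A \subset B -> (f A <= f B)%E) /\
  (forall (A B : {set V}) (v : V), A \subset B -> v \notin B ->
     (f (v |: B) - f B <= f (v |: A) - f A)%E).
Proof.
set mu := fun phi : {ffun V -> option V * option bool} =>
  \prod_v live_edge_weight E w qp qm v (phi v).
have mu_ge0 phi : 0 <= mu phi.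
  by apply: prodr_ge0 => v _; exact: live_edge_weight_ge0.
have [F hF] := choice (fun phi : {ffun V -> option V * option bool} =>
  card_positive_coverage phi R #|V|).
have fE S : fplus E w qp qm S =
    (\sum_phi mu phi * \sum_v (meets S (F phi v))%:R)%:E.
  by rewrite fplus_live_edge//; congr EFin; apply: eq_bigr => phi _; rewrite hF.
split=> [A B AB|A B v AB _]; rewrite /= !fE.
  rewrite lee_fin; apply: ler_sum => phi _; apply: ler_wpM2l => //.
  apply: ler_sum => u _; have := @meets_sub _ A B (F phi u) AB.
  by case: (meets A _); case: (meets B _) => // /(_ isT).
rewrite -!EFinB lee_fin -!sumrB; apply: ler_sum => phi _.
rewrite -!mulrBr; apply: ler_wpM2l => //.
by rewrite -!sumrB; apply: ler_sum => u _; exact: meets_submodular.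
Qed.
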